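(* Let $n\ge 1$, $r>1$, let $\rho>0$ be a probability density on $\mathbb{R}^n$ with $\int_{\mathbb{R}^n}\rho^{1/(r+1)}\,dx<\infty$, and put $\gamma:=\left(\int_{\mathbb{R}^n}\rho^{1/(r+1)}\,dx\right)^{-1}$ and $m:=\gamma\,\rho^{1/(r+1)}$. Let $C\ge 1\ge c>0$, and assume that the probability measure $m\,dx$ satisfies the Poincar\'e inequality with constant $C_P=C_P(m)$. Then $$\mathcal{F}_\rho[f]-\mathcal{F}_\rho[m]\le K\,I_\rho[f]\qquad\text{for all } f\in\mathcal{P}_{c,C},$$ with $$K=\frac{C_P\,C^{2r+3}}{2r(r+1)\,\gamma^{r+1}\,c^{r+2}}.$$
   Context: $\mathcal{P}(\mathbb{R}^n)$ is the space of probability densities on $\mathbb{R}^n$, and $\mathcal{P}_{c,C}:=\{g\in\mathcal{P}(\mathbb{R}^n): c\,m\le g\le C\,m\}$. The functional is $\mathcal{F}_\rho[f]:=\int_{\mathbb{R}^n}\frac{\rho(x)}{f^r(x)}\,dx$. With $u:=f/m$, $$I_\rho[f]:=r^2\int_{\mathbb{R}^n}u\,\left|\nabla\left(u^{-(r+1)}\right)\right|^2 m\,dx .$$ The Poincar\'e inequality (associated to $m$) holds with constant $C_P$ if $$\int_{\mathbb{R}^n}g^2\,m\,dx-\left(\int_{\mathbb{R}^n}g\,m\,dx\right)^2\le C_P\int_{\mathbb{R}^n}|\nabla g|^2\,m\,dx$$ for all functions $g$ (for which these expressions make sense). *)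

(* Defs.v *)
From HB Require Import structures.
From mathcomp Require Import all_boot all_order all_algebra.
From mathcomp Require Import all_classical all_reals all_analysis.

Set Implicit Arguments.
Unset Strict Implicit.
Unset Printing Implicit Defensive.

Import Order.TTheory GRing.Theory Num.Theory.
Import numFieldNormedType.Exports.

Local Open Scope classical_set_scope.
Local Open Scope ring_scope.

(* 'rV[R]_n carries the sigma-algebra generated by the coordinates, i.e. the
   Borel sigma-algebra of R^n. *)
Section rV_measurable.
Context {R : realType} (n : nat).

Let coord (i : 'I_n) (x : 'rV[R]_n) : R := x ord0 i.

Let rV_set0 : g_sigma_preimage coord set0.
Proof. exact: sigma_algebra0. Qed.

Let rV_setC A : g_sigma_preimage coord A -> g_sigma_preimage coord (~` A).
Proof. exact: sigma_algebraC. Qed.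

Let rV_bigcup (F : _^nat) : (forall i, g_sigma_preimage coord (F i)) ->
  g_sigma_preimage coord (\bigcup_i (F i)).
Proof. exact: sigma_algebra_bigcup. Qed.

HB.instance Definition _ :=
  @isMeasurable.Build (measure_tuple_display default_measure_display)
    'rV[R]_n (g_sigma_preimage coord) rV_set0 rV_setC rV_bigcup.

End rV_measurable.

Section rV_measurable_fun.
Context {R : realType}.

Lemma measurable_rV_coord n (i : 'I_n) :
  measurable_fun setT (fun x : 'rV[R]_n => x ord0 i).
Proof.
move=> _ Y mY; rewrite setTI; apply: sub_sigma_algebra => /=.
rewrite -bigcup_seq/=; exists i => /=; first by rewrite mem_index_enum.
by exists Y => //; rewrite setTI.
Qed.

Lemma measurable_fun_rVP d (T : measurableType d) n (f : T -> 'rV[R]_n) :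
  (forall i, measurable_fun setT (fun t => f t ord0 i)) -> measurable_fun setT f.
Proof.
move=> mf _ A mA; rewrite setTI.
have : g_sigma_preimage (fun i t => f t ord0 i) `<=` @measurable _ T.
  apply: smallest_sub; first exact: sigma_algebra_measurable.
  case: n => [|n] in f mf A mA *; first by rewrite big_ord0.
  rewrite -bigcup_mkord_ord; apply: bigcup_sub => i Ii.
  by move=> B [C mC <-]; exact: mf.
apply; rewrite (g_sigma_preimage_comp (fun i (x : 'rV[R]_n) => x ord0 i) f).
by exists A => //; rewrite setTI.
Qed.

Definition cons_rV n (p : measurableTypeR R * 'rV[R]_n) : 'rV[R]_n.+1 :=
  row_mx p.1%:M p.2.

Lemma cons_rV0 n p : @cons_rV n p ord0 ord0 = p.1.
Proof.
transitivity ((p.1%:M : 'M[R]_1) ord0 ord0); last by rewrite mxE eqxx mulr1n.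
rewrite -(row_mxEl (p.1%:M : 'M[R]_1) p.2 ord0 ord0).
by congr (row_mx _ _ _ _); exact/val_inj.
Qed.

Lemma cons_rVS n p (i : 'I_n) : cons_rV p ord0 (lift ord0 i) = p.2 ord0 i.
Proof.
rewrite -(row_mxEr (p.1%:M : 'M[R]_1) p.2 ord0 i).
by congr (row_mx _ _ _ _); exact/val_inj.
Qed.

Lemma measurable_cons_rV n : measurable_fun setT (@cons_rV n).
Proof.
apply: measurable_fun_rVP => i; case: (unliftP ord0 i) => [j|] ->.
  under eq_fun do rewrite cons_rVS.
  by apply: (measurableT_comp (@measurable_rV_coord n j)).
under eq_fun do rewrite cons_rV0.
exact: measurable_fst.
Qed.

Definition uncons_rV n (x : 'rV[R]_n.+1) : measurableTypeR R * 'rV[R]_n :=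
  (x ord0 ord0, \row_i x ord0 (lift ord0 i)).

Lemma measurable_uncons_rV n : measurable_fun setT (@uncons_rV n).
Proof.
apply: measurable_fun_pair; first exact: measurable_rV_coord.
apply: measurable_fun_rVP => i /=.
under eq_fun do rewrite mxE; exact: measurable_rV_coord.
Qed.

Lemma cons_rVK n : cancel (@cons_rV n) (@uncons_rV n).
Proof.
move=> [a y]; congr pair; first by rewrite cons_rV0.
by apply/rowP => i; rewrite mxE cons_rVS.
Qed.

Lemma uncons_rVK n : cancel (@uncons_rV n) (@cons_rV n).
Proof.
move=> x; apply/rowP => i; case: (unliftP ord0 i) => [j|] ->.
  by rewrite cons_rVS mxE.
by rewrite cons_rV0.
Qed.

End rV_measurable_fun.

Section lebesgue_rV.
Context {R : realType}.
Local Open Scope ereal_scope.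

Section step.
Variables (n : nat) (mu : {sigma_finite_measure set 'rV[R]_n -> \bar R}).

Definition lebesgue_rV_step : set 'rV[R]_n.+1 -> \bar R :=
  pushforward (lebesgue_measure \x mu) (@cons_rV R n).

HB.instance Definition _ := Measure.copy lebesgue_rV_step
  (measure_function_pushforward__canonical__measure_function_Measure
     (lebesgue_measure \x mu) (@measurable_cons_rV R n)).

(* Proved here because the sigma-finite structure on [\x] found by inference
   only applies to subprobabilities. *)
Let step_sigma_finite : sigma_finite setT lebesgue_rV_step.
Proof.
have /sigma_finiteP[F [TF ndF Foo]] :=
  sigma_finiteT (@lebesgue_measure R : {sigma_finite_measure set _ -> \bar R}).
have /sigma_finiteP[G [TG ndG Goo]] := sigma_finiteT mu.
exists (fun k => @uncons_rV R n @^-1` (F k `*` G k)).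
  apply/seteqP; split=> // x _.
  have [i _ Fi] : (\bigcup_i F i) (uncons_rV x).1 by rewrite -TF.
  have [j _ Gj] : (\bigcup_i G i) (uncons_rV x).2 by rewrite -TG.
  exists (maxn i j) => //; split.
    by move: Fi; exact/subsetPset/ndF/leq_maxl.
  by move: Gj; exact/subsetPset/ndG/leq_maxr.
move=> k; have [mF Fk] := Foo k; have [mG Gk] := Goo k.
split.
  rewrite -[X in measurable X]setTI; apply: measurable_uncons_rV => //.
  exact: measurableX.
rewrite /lebesgue_rV_step /pushforward (_ : _ @^-1` _ = F k `*` G k).
  by rewrite product_measure1E// lte_mul_pinfty// ge0_fin_numE.
rewrite -comp_preimage (_ : _ \o _ = id) ?preimage_id//.
exact/funext/cons_rVK.
Qed.

HB.instance Definition _ :=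
  Measure_isSigmaFinite.Build _ _ _ lebesgue_rV_step step_sigma_finite.

End step.

Fixpoint lebesgue_rV n : {sigma_finite_measure set 'rV[R]_n -> \bar R} :=
  match n with
  | 0 => [the {sigma_finite_measure set 'rV[R]_0 -> \bar R} of \d_(0%R : 'rV[R]_0)]
  | n'.+1 => [the {sigma_finite_measure set 'rV[R]_n'.+1 -> \bar R} of
              lebesgue_rV_step (lebesgue_rV n')]
  end.

End lebesgue_rV.

Section lebesgue_rV_box.
Context {R : realType}.
Local Open Scope ereal_scope.

(* Boxes form a generating pi-system, so this characterizes [lebesgue_rV n]
   as the n-dimensional Lebesgue measure. *)
Lemma lebesgue_rV_box n (A : 'I_n -> set (measurableTypeR R)) :
  (forall i, measurable (A i)) ->
  @lebesgue_rV R n [set x | forall i, A i (x ord0 i)] =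
  \prod_(i < n) @lebesgue_measure R (A i).
Proof.
elim: n A => [|n IHn] A mA.
  rewrite big_ord0 (_ : mkset _ = setT); first exact: diracT.
  by apply/seteqP; split=> // x _ [].
rewrite big_ord_recl -IHn//=.
have mB : measurable
    [set x : 'rV[R]_n | forall i, A (lift ord0 i) (x ord0 i)].
  rewrite (_ : mkset _ = \bigcap_(i in [set: 'I_n])
      ((fun x : 'rV[R]_n => x ord0 i) @^-1` A (lift ord0 i))); last first.
    by apply/seteqP; split=> [x Ax i _|x Ax i]; [exact: Ax|exact: (Ax i)].
  apply: fin_bigcap_measurable => // i _.
  rewrite -[X in measurable X]setTI.
  exact: (@measurable_rV_coord R n i measurableT _ (mA (lift ord0 i))).
transitivity ((lebesgue_measure \x lebesgue_rV n) (A ord0 `*`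
    [set x : 'rV[R]_n | forall i, A (lift ord0 i) (x ord0 i)])).
  congr (product_measure1 _ _ _).
  apply/seteqP; split=> [p Ap|p [Ap1 Ap2] i]/=.
    split=> [|i]/=; first by rewrite -(cons_rV0 p); exact: Ap.
    by rewrite -cons_rVS; exact: Ap.
  by case: (unliftP ord0 i) => [j|] ->; rewrite ?cons_rVS ?cons_rV0//.
by rewrite product_measure1E.
Qed.

End lebesgue_rV_box.

Section sobolev.
Context {R : realType} (n : nat).
Local Notation leb := (@lebesgue_rV R n).
Implicit Types (g phi : 'rV[R]_n -> R) (G : 'rV[R]_n -> 'rV[R]_n).

Definition basis_vec (i : 'I_n) : 'rV[R]_n := delta_mx ord0 i.

(* The norm carried by 'rV[R]_n is the sup norm; |v|^2 in the integrals below
   is Euclidean. *)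
Definition sqnorm (v : 'rV[R]_n) : R := \sum_(i < n) v ord0 i ^+ 2.

Definition locally_integrable_rV g :=
  measurable_fun setT g /\
  forall K : set 'rV[R]_n, compact K ->
    (\int[leb]_(x in K) `|g x|%:E < +oo)%E.

(* C^1 test functions define the same weak gradients as C^infty ones. *)
Definition test_function phi :=
  [/\ forall x, differentiable phi x,
      forall i, continuous ('D_(basis_vec i) phi) &
      compact (closure [set x | phi x != 0])].

Definition is_weak_gradient g G :=
  [/\ locally_integrable_rV g,
      forall i, locally_integrable_rV (fun x => G x ord0 i) &
      forall phi, test_function phi -> forall i,
        \int[leb]_x (g x * 'D_(basis_vec i) phi x) =
        - \int[leb]_x (G x ord0 i * phi x)].

Definition weakly_differentiable g := exists G, is_weak_gradient g G.

(* A weak gradient is unique up to a null set; [weak_gradient g] is a chosen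
   representative, and is 0 when g has no weak gradient. *)
Definition weak_gradient g : 'rV[R]_n -> 'rV[R]_n :=
  xget (fun=> 0) [set G | is_weak_gradient g G].

(* The g "for which the expressions make sense" are the weakly differentiable
   g with g^2 m integrable (so that, m dx being finite, g m is integrable too);
   the right-hand side may be +oo. *)
Definition poincare (m : 'rV[R]_n -> R) (CP : R) :=
  forall g, weakly_differentiable g ->
    (\int[leb]_x (g x ^+ 2 * m x)%:E < +oo)%E ->
    (\int[leb]_x (g x ^+ 2 * m x)%:E - (\int[leb]_x (g x * m x)%:E) ^+ 2
     <= CP%:E * \int[leb]_x (sqnorm (weak_gradient g x) * m x)%:E)%E.

Definition prob_density g :=
  [/\ measurable_fun setT g, forall x, 0 <= g x & (\int[leb]_x (g x)%:E = 1)%E].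

(* Densities are understood up to null sets, hence the a.e. bounds. *)
Definition pinched_density (m : 'rV[R]_n -> R) (c C : R) g :=
  prob_density g /\ {ae leb, forall x, c * m x <= g x <= C * m x}.

Section functional.
Variables (r : R) (rho : 'rV[R]_n -> R).

Definition gamma : R := (\int[leb]_x (rho x `^ (r + 1)^-1))^-1.

Definition minimizer (x : 'rV[R]_n) : R := gamma * rho x `^ (r + 1)^-1.

Definition energy (f : 'rV[R]_n -> R) : \bar R :=
  (\int[leb]_x (rho x / f x `^ r)%:E)%E.

(* Equal to +oo by convention when u^{-(r+1)} has no weak gradient. *)
Definition dissipation (f : 'rV[R]_n -> R) : \bar R :=
  let u x := f x / minimizer x in
  let w x := u x `^ (- (r + 1)) in
  if `[< weakly_differentiable w >] then
    ((r ^+ 2)%:E *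
     \int[leb]_x (u x * sqnorm (weak_gradient w x) * minimizer x)%:E)%E
  else +oo%E.

End functional.
End sobolev.

(* Main.v *)
Require Import Defs.
From mathcomp Require Import all_boot all_order all_algebra.
From mathcomp Require Import all_classical all_reals all_analysis.
From mathcomp Require Import measurable_realfun.
From mathcomp Require Import ring lra.

Set Implicit Arguments.
Unset Strict Implicit.
Unset Printing Implicit Defensive.

Import Order.TTheory GRing.Theory Num.Theory.
Import numFieldNormedType.Exports.
Local Open Scope classical_set_scope.
Local Open Scope ring_scope.

(** Write m for the minimizer, u = f / m, w = u^-(r+1) and
    Gam = gamma^(r+1). Since m^(r+1) = Gam * rho, the energy is
    Gam^-1 * int u^-r m, and it equals Gam^-1 at f = m; so the energy gap is
    Gam^-1 * (int u^-r m - 1), where int u m = 1 and c <= u <= C.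

    The gap is bounded by the variance of w rather than by that of u. Let W be
    the mean of w with respect to m dx, and b the number with b^-(r+1) = W.
    The tangent line of t^-r at b has slope -r W, and the distance of u^-r to
    it is at most r / (2 (r+1)) * C^(r+2) * (w - W)^2 ([powR_tangent_gap]).
    Integrated against m, the tangent part is its value at u = 1, which is at
    most 1 by convexity ([powR_tangent_at1]). Hence
      int u^-r m - 1 <= r / (2 (r+1)) * C^(r+2) * Var(w)
    ([powR_deficit_le_variance]). Applied to w itself, the Poincaré inequality
    produces the gradient of w, the very one that the dissipation contains
    with the additional factor r^2 u, where u >= c. The constant obtained has
    C^(r+2) / c in place of C^(2r+3) / c^(r+2), which is at least as
    large because c <= 1 <= C.

    If w has no weak gradient then the dissipation is +oo, and the bound says
    something only through the sign of the constant: it holds because CP > 0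
    ([poincare_constant_gt0]). Otherwise every weakly differentiable function
    in L^2(m) would be constant almost everywhere, but arctan of a coordinate
    is not. That this function is weakly differentiable rests on integration
    by parts in R^n ([is_weak_gradient_C1]), which reduces to the vanishing of
    the integral of a partial derivative with compact support
    ([integral_partial_eq0]). *)

(** * Tangent inequalities for negative powers *)

(** The derivative only has to point away from b between 0 and max(b, u): the
    function to which this is applied has the right monotonicity only up to
    the upper bound C of u. *)
Lemma valley_le (R : realType) (F dF : R -> R) (b u : R) :
    0 < b -> 0 < u ->
    (forall t : R, 0 < t -> is_derive t 1 F (dF t)) ->
    (forall t, 0 < t -> t <= Num.max b u -> 0 <= (t - b) * dF t) ->
  F b <= F u.
Proof.
move=> b0 u0 dFE sgn.
have cF x y : 0 < x -> {within `[x, y], continuous F}.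
  move=> x0; apply: derivable_within_continuous => t.
  rewrite in_itv/= => /andP[xt _]; have /dFE dFt := lt_le_trans x0 xt.
  exact: ex_derive.
have [bu|ub|->//] := ltgtP b u.
- have [|t|t] := @MVT _ F dF _ _ bu.
  + by move=> t; rewrite in_itv/= => /andP[bt _]; apply/dFE/(lt_trans b0).
  + exact: cF.
  + rewrite in_itv/= => /andP[bt tu] E.
    have := sgn _ (lt_trans b0 bt); rewrite le_max (ltW tu) orbT => /(_ isT).
    rewrite pmulr_rge0 ?subr_gt0// => dF0.
    by rewrite -subr_ge0 E mulr_ge0// subr_ge0 ltW.
- have [|t|t] := @MVT _ F dF _ _ ub.
  + by move=> t; rewrite in_itv/= => /andP[bt _]; apply/dFE/(lt_trans u0).
  + exact: cF.
  + rewrite in_itv/= => /andP[ut tb] E.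
    have := sgn _ (lt_trans u0 ut); rewrite le_max (ltW tb) => /(_ isT).
    rewrite nmulr_rge0 ?subr_lt0// => dF0.
    by rewrite -subr_le0 E mulr_le0_ge0// subr_ge0 ltW.
Qed.

Lemma ler_powRN (R : realType) (p x y : R) : 0 <= p -> 0 < x -> x <= y ->
  y `^ (- p) <= x `^ (- p).
Proof.
move=> p0 x0 xy; rewrite !powRN lef_pV2 ?posrE ?powR_gt0 ?(lt_le_trans x0)//.
by apply: ge0_ler_powR; rewrite ?nnegrE// ltW// (lt_le_trans x0).
Qed.

(** As a function of u, the right side minus the left side vanishes at u = b
    and has derivative
    r (u^-(r+1) - b^-(r+1)) (1 - C^(r+2) u^-(r+2)).
    For u <= C the last factor is nonpositive and the middle one has the sign
    of b - u, so b is the minimum. The constant is the one that makes the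
    derivative factor. *)
Lemma powR_tangent_gap (R : realType) (r C b u : R) :
    0 < r -> 0 < b -> b <= C -> 0 < u -> u <= C ->
  u `^ (- r) + r * b `^ (- (r + 1)) * u - (r + 1) * b `^ (- r) <=
  r / (2 * (r + 1)) * C `^ (r + 2) * (u `^ (- (r + 1)) - b `^ (- (r + 1))) ^+ 2.
Proof.
move=> r0 b0 bC u0 uC; have C0 := lt_le_trans u0 uC.
have r1 : 0 < r + 1 by lra.
set B := b `^ (- (r + 1)); set A := r / (2 * (r + 1)) * C `^ (r + 2).
have BE : B * b = b `^ (- r).
  rewrite -[b in X in X = _]powRr1 ?ltW// -powRD ?(gt_eqF b0) ?implybT//.
  by congr (_ `^ _); ring.
pose F t := A * (t `^ (- (r + 1)) - B) ^+ 2 - t `^ (- r) - r * B * t.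
pose dF t := r * (t `^ (- (r + 1)) - B) * (1 - C `^ (r + 2) * t `^ (- (r + 2))).
suff : F b <= F u by rewrite /F -/B subrr expr0n/= mulr0 -mulrA BE; lra.
apply: (@valley_le _ F dF _ _ b0 u0) => [t t0|t t0].
  have tp p : is_derive t 1 (@powR R ^~ p) (p * t `^ (p - 1)).
    exact: is_derive1_powR.
  rewrite /F; apply: is_derive_eq.
  rewrite ?subr0 ?add0r /GRing.scale/= /dF /A.
  rewrite (_ : - (r + 1) - 1 = - (r + 2)); last by ring.
  rewrite (_ : - r - 1 = - (r + 1)); last by ring.
  by field; lra.
have tC : t <= Num.max b u -> t <= C.
  by move=> tm; rewrite (le_trans tm)// ge_max bC.
move=> /tC {}tC; rewrite /dF.
have D0 : 1 - C `^ (r + 2) * t `^ (- (r + 2)) <= 0.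
  rewrite subr_le0 powRN ler_pdivlMr ?powR_gt0// mul1r.
  by apply: ge0_ler_powR; rewrite ?nnegrE; lra.
have [tb|bt] := leP t b.
  have : B <= t `^ (- (r + 1)) by apply: ler_powRN => //; lra.
  rewrite -subr_ge0 => Bt.
  by apply: mulr_le0; rewrite ?subr_le0// mulr_ge0_le0// mulr_ge0// ltW.
have : t `^ (- (r + 1)) <= B by apply: ler_powRN; lra.
rewrite -subr_le0 => Bt.
by rewrite mulr_ge0 ?[0 <= t - b]ltW ?subr_gt0// mulr_le0// mulr_ge0_le0// ltW.
Qed.

(** The convex function t^-r lies above its tangent line at b; this is that
    fact at t = 1. *)
Lemma powR_tangent_at1 (R : realType) (r b : R) : 0 < r -> 0 < b ->
  (r + 1) * b `^ (- r) <= 1 + r * b `^ (- (r + 1)).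
Proof.
move=> r0 b0; set B := b `^ (- (r + 1)).
have BE : B * b = b `^ (- r).
  rewrite -[b in X in X = _]powRr1 ?ltW// -powRD ?(gt_eqF b0) ?implybT//.
  by congr (_ `^ _); ring.
pose F t := t `^ (- r) + r * B * t; pose dF t := r * (B - t `^ (- (r + 1))).
suff : F b <= F 1 by rewrite /F powR1 mulr1 -mulrA BE; lra.
apply: (@valley_le _ F dF _ _ b0 ltr01) => [t t0|t t0 _].
  have tp p : is_derive t 1 (@powR R ^~ p) (p * t `^ (p - 1)).
    exact: is_derive1_powR.
  rewrite /F; apply: is_derive_eq.
  rewrite ?subr0 ?add0r /GRing.scale/= /dF.
  rewrite (_ : - r - 1 = - (r + 1)); last by ring.
  by ring.
rewrite /dF.
have [tb|bt] := leP t b.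
  have : B <= t `^ (- (r + 1)) by apply: ler_powRN => //; lra.
  rewrite -subr_le0 => Bt; apply: mulr_le0; rewrite ?subr_le0//.
  by rewrite mulr_ge0_le0// ltW.
have : t `^ (- (r + 1)) <= B by apply: ler_powRN; lra.
rewrite -subr_ge0 => Bt.
by rewrite mulr_ge0 ?[0 <= t - b]ltW ?subr_gt0// mulr_ge0// ltW.
Qed.

(** * Integrals against a probability density *)

Lemma ge0_integral_eq0_ae d (T : measurableType d) (R : realType)
    (mu : {measure set T -> \bar R}) (h : T -> R) :
    measurable_fun setT h -> (forall x, 0 <= h x) ->
    (\int[mu]_x (h x)%:E = 0)%E ->
  {ae mu, forall x, h x = 0}.
Proof.
move=> mh h0 ih.
have /(ae_eq_integral_abs _ measurableT (proj2 (measurable_EFinP _ _) mh)) :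
    (\int[mu]_x `|(h x)%:E| = 0)%E.
  by under eq_integral do rewrite gee0_abs ?lee_fin//.
by apply: filterS => x /(_ I)/eqP; rewrite /cst eqe => /eqP.
Qed.

Lemma ae_eq_integral_EFin d (T : measurableType d) (R : realType)
    (mu : {measure set T -> \bar R}) (h k : T -> R) :
    measurable_fun setT h -> measurable_fun setT k ->
    {ae mu, forall x, h x = k x} ->
  (\int[mu]_x (h x)%:E = \int[mu]_x (k x)%:E)%E.
Proof.
move=> mh mk hk; apply: (ae_eq_integral (EFin \o k) (EFin \o h)) => //.
- exact/measurable_EFinP.
- exact/measurable_EFinP.
- by apply: filterS hk => x /= -> _.
Qed.

Lemma EFin_Rintegral d (T : measurableType d) (R : realType)
    (mu : {measure set T -> \bar R}) (h : T -> R) :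
    mu.-integrable setT (EFin \o h) ->
  (\int[mu]_x (h x)%:E)%E = (\int[mu]_x h x)%:E.
Proof. by move=> ih; rewrite /Rintegral fineK//; exact: integrable_fin_num. Qed.

Lemma Rintegral_addZ d (T : measurableType d) (R : realType)
    (mu : {measure set T -> \bar R}) (f g : T -> R) (k : R) :
    mu.-integrable setT (EFin \o f) -> mu.-integrable setT (EFin \o g) ->
  mu.-integrable setT (EFin \o (fun x => f x + k * g x)) /\
  \int[mu]_x (f x + k * g x) = \int[mu]_x f x + k * \int[mu]_x g x.
Proof.
move=> fi gi; have kgi := integrableZl measurableT k gi; split.
  exact: (integrableD measurableT fi kgi).
by rewrite RintegralD ?RintegralZl.
Qed.

Section weighted_mean.
Context d (T : measurableType d) (R : realType).
Variable mu : {measure set T -> \bar R}.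
Variable m : T -> R.
Hypotheses (mm : measurable_fun setT m) (m0 : forall x, 0 <= m x)
  (m1 : (\int[mu]_x (m x)%:E = 1)%E).

Lemma integrable_density : mu.-integrable setT (EFin \o m).
Proof.
apply/integrableP; split; first exact/measurable_EFinP.
by under eq_integral do rewrite /= ger0_norm//; rewrite m1 ltry.
Qed.

Lemma integrable_bounded_density (h : T -> R) (M : R) :
    measurable_fun setT h -> (forall x, `|h x| <= M) ->
  mu.-integrable setT (EFin \o (fun x => h x * m x)).
Proof.
move=> mh hM.
apply: (@le_integrable _ _ _ _ _ measurableT _ (fun x => M%:E * (m x)%:E)%E).
- by apply/measurable_EFinP; exact: measurable_funM.
- move=> x _ /=; rewrite lee_fin normrM [leRHS]normrM ler_wpM2r//.
  by rewrite (le_trans (hM x))// ler_norm.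
- exact: (integrableZl measurableT M integrable_density).
Qed.

Lemma integrable_sqr_bounded_density (h : T -> R) (M : R) :
    measurable_fun setT h -> (forall x, `|h x| <= M) ->
  mu.-integrable setT (EFin \o (fun x => h x ^+ 2 * m x)).
Proof.
move=> mh hM; apply: (@integrable_bounded_density _ (M ^+ 2)) => [|x].
  exact: measurable_funX.
by rewrite normrX lerXn2r ?nnegrE// (le_trans _ (hM x)).
Qed.

Lemma Rintegral_density : \int[mu]_x m x = 1.
Proof. by rewrite /Rintegral m1. Qed.

(** In this form the variance is the integral of a nonnegative function, so
    that its vanishing makes h constant almost everywhere where m > 0. *)
Lemma variance_centered (h : T -> R) (M : R) :
    measurable_fun setT h -> (forall x, `|h x| <= M) ->
  let a := \int[mu]_x (h x * m x) in
  \int[mu]_x ((h x - a) ^+ 2 * m x) = \int[mu]_x (h x ^+ 2 * m x) - a ^+ 2.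
Proof.
move=> mh hM a.
have ih := integrable_bounded_density mh hM.
have ih2 := integrable_sqr_bounded_density mh hM.
have im := integrable_density.
have [i1 E1] := Rintegral_addZ (- (2 * a)) ih2 ih.
have [i2 E2] := Rintegral_addZ (a ^+ 2) i1 im.
transitivity (\int[mu]_x
    (h x ^+ 2 * m x + - (2 * a) * (h x * m x) + a ^+ 2 * m x)).
  by apply: eq_Rintegral => x _; ring.
rewrite E2 E1 Rintegral_density -/a; ring.
Qed.

(** Let W be the mean of w = u^-(r+1), and b the number with b^-(r+1) = W. The
    gap inequality at b compares u^-r with its tangent line, and the error
    term is (w - W)^2, whose mean is the variance. As u has mean 1, the tangent
    part integrates to (r + 1) b^-r - r W, which is at most 1. *)
Lemma powR_deficit_le_variance (u : T -> R) (r c C : R) :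
    0 < r -> 0 < c -> measurable_fun setT u -> (forall x, c <= u x <= C) ->
    \int[mu]_x (u x * m x) = 1 ->
  \int[mu]_x (u x `^ (- r) * m x) - 1 <=
  r / (2 * (r + 1)) * C `^ (r + 2) *
  (\int[mu]_x ((u x `^ (- (r + 1))) ^+ 2 * m x) -
   (\int[mu]_x (u x `^ (- (r + 1)) * m x)) ^+ 2).
Proof.
move=> r0 c0 mu_ cuC u1.
have u0 x : 0 < u x by case/andP: (cuC x) => /(lt_le_trans c0).
have uC x : u x <= C by case/andP: (cuC x).
have r1 : 0 < r + 1 by lra.
have mpow p : measurable_fun setT (fun x => u x `^ p).
  exact: (measurableT_comp (measurable_powR p)).
have powN_bd p x : 0 <= p -> `|u x `^ (- p)| <= c `^ (- p).
  move=> p0; rewrite ger0_norm ?powR_ge0//; apply: ler_powRN => //.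
  by case/andP: (cuC x).
set w := fun x => u x `^ (- (r + 1)); set A := _ * C `^ _.
have iu : mu.-integrable setT (EFin \o (fun x => u x * m x)).
  by apply: (@integrable_bounded_density _ C) => // x; rewrite gtr0_norm.
have ir := integrable_bounded_density (mpow _) (fun x => powN_bd _ x (ltW r0)).
have iw : mu.-integrable setT (EFin \o (fun x => w x * m x)) :=
  integrable_bounded_density (mpow _) (fun x => powN_bd _ x (ltW r1)).
have iw2 : mu.-integrable setT (EFin \o (fun x => w x ^+ 2 * m x)) :=
  integrable_sqr_bounded_density (mpow _) (fun x => powN_bd _ x (ltW r1)).
have im := integrable_density.
set W := \int[mu]_x (w x * m x).
(* T is inhabited, since m has mass 1; hence C is positive. *)
have [x0 _] : exists x : T, True.
  apply: contrapT => noT; have: (0 : \bar R)%E = 1%E.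
    rewrite -m1 (_ : setT = set0) ?integral_set0//.
    by apply/seteqP; split=> // x _; apply: noT; exists x.
  by move/eqP; rewrite eqe eq_sym oner_eq0.
have C0 : 0 < C by exact: lt_le_trans (u0 x0) (uC x0).
have CW : C `^ (- (r + 1)) <= W.
  have -> : C `^ (- (r + 1)) = \int[mu]_x (C `^ (- (r + 1)) * m x).
    by rewrite RintegralZl// Rintegral_density mulr1.
  apply: le_Rintegral => //; first exact: (integrableZl measurableT _ im).
  move=> x _; apply: ler_wpM2r => //.
  exact: (ler_powRN (ltW r1) (u0 x) (uC x)).
have W0 : 0 < W by rewrite (lt_le_trans _ CW)// powR_gt0.
(* b is the value of u at which w takes its mean W. *)
pose b := W `^ (- (r + 1)^-1).
have b0 : 0 < b by exact: powR_gt0.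
have bW : b `^ (- (r + 1)) = W.
  by rewrite -powRrM mulrNN mulVf ?gt_eqF// powRr1// ltW.
have bC : b <= C.
  have := @ler_powRN _ (r + 1)^-1 _ _ _ (powR_gt0 _ C0) CW.
  rewrite -powRrM mulrNN mulfV ?gt_eqF// powRr1 ?(ltW C0)//; apply.
  by rewrite invr_ge0 ltW.
(* The gap inequality at b, expanded into integrable terms. *)
have tangent x : u x `^ (- r) * m x <= (r + 1) * b `^ (- r) * m x
    + (- (r * W)) * (u x * m x)
    + A * (w x ^+ 2 * m x) + (- (2 * A * W)) * (w x * m x) + A * W ^+ 2 * m x.
  have := powR_tangent_gap r0 b0 bC (u0 x) (uC x).
  rewrite bW -/A -/(w x) => /(ler_wpM2r (m0 x)); lra.
have LE : \int[mu]_x (u x `^ (- r) * m x) <= (r + 1) * b `^ (- r)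
    + (- (r * W)) + A * (\int[mu]_x (w x ^+ 2 * m x) - W ^+ 2).
  have [i1 E1] := Rintegral_addZ (- (r * W))
    (integrableZl measurableT ((r + 1) * b `^ (- r)) im) iu.
  have [i2 E2] := Rintegral_addZ A i1 iw2.
  have [i3 E3] := Rintegral_addZ (- (2 * A * W)) i2 iw.
  have [i4 E4] := Rintegral_addZ (A * W ^+ 2) i3 im.
  apply: le_trans (le_Rintegral measurableT ir i4 (fun x _ => tangent x)) _.
  rewrite E4 E3 E2 E1 (RintegralZl _ measurableT im) Rintegral_density u1 -/W.
  lra.
have := powR_tangent_at1 r0 b0; rewrite bW; lra.
Qed.

End weighted_mean.

(** * The Borel sets of R^n *)

Section borel_rV.
Context (R : realType) (n : nat).

(* The cube of the grid of mesh 1 / (k + 1) that is indexed by z. *)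
Let cell (k : nat) (z : 'rV[int]_n) : set 'rV[R]_n :=
  [set x | forall i, Num.floor (k.+1%:R * x ord0 i) = z ord0 i].

Let measurable_cell k z : measurable (cell k z).
Proof.
have -> : cell k z = \bigcap_(i in [set: 'I_n])
    ((fun x : 'rV[R]_n => x ord0 i) @^-1`
      [set t | (z ord0 i)%:~R <= k.+1%:R * t < (z ord0 i + 1)%:~R]).
  apply/seteqP; split=> [x xz i _ /=|x xz i]; first by
    rewrite -(xz i) floor_itv.
  exact: floor_def (xz i I).
apply: fin_bigcap_measurable => // i _; rewrite -[X in measurable X]setTI.
apply: (@measurable_rV_coord R n i measurableT).
have -> : [set t : R | (z ord0 i)%:~R <= k.+1%:R * t < (z ord0 i + 1)%:~R] =
    `[(z ord0 i)%:~R / k.+1%:R, (z ord0 i + 1)%:~R / k.+1%:R[%classic.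
  apply/seteqP; split=> t /=; rewrite in_itv/= ler_pdivrMr ?ltr0n//
    ltr_pdivlMr ?ltr0n//; by rewrite mulrC.
exact: measurable_itv.
Qed.

(** The sigma-algebra is generated by the coordinates, and an open set is the
    union of the countably many grid cubes that it contains. *)
Lemma open_measurable_rV (U : set 'rV[R]_n) : open U -> measurable U.
Proof.
move=> oU.
have -> : U = \bigcup_(kz : nat * 'rV[int]_n)
    if `[< cell kz.1 kz.2 `<=` U >] then cell kz.1 kz.2 else set0.
  apply/seteqP; split=> [x Ux|x [kz _]]; last by case: asboolP => // + ?; apply.
  have /nbhs_ballP[e /= e0 eU] : nbhs x U by exact: open_nbhs_nbhs.
  pose k := Num.truncn e^-1.
  exists (k, \row_i Num.floor (k.+1%:R * x ord0 i)) => //=.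
  case: asboolP => [_ i|]; first by rewrite mxE.
  move=> cellU; exfalso; apply: cellU => y ycell; apply: eU; split=> // a i.
  have -> : a = ord0 by exact: ord1.
  have := ycell i; rewrite mxE => yx.
  have k0 : (0 : R) < k.+1%:R by rewrite ltr0n.
  have ke : e^-1 < k.+1%:R by rewrite truncnS_gt.
  have := floor_itv (k.+1%:R * x ord0 i).
  have := floor_itv (k.+1%:R * y ord0 i); rewrite yx.
  rewrite !intrD => /andP[y1 y2] /andP[x1 x2].
  rewrite /ball /= -(ltr_pM2l k0) -[k.+1%:R in ltLHS](gtr0_norm k0).
  rewrite -normrM mulrBr.
  apply: (@lt_trans _ _ 1); first by rewrite ltr_norml; lra.
  by rewrite -ltr_pdivrMr// div1r.
apply: countable_bigcupT_measurable => [|kz]; first exact: countableP.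
by case: asboolP => _ //; exact: measurable_cell.
Qed.

Lemma closed_measurable_rV (A : set 'rV[R]_n) : closed A -> measurable A.
Proof.
move=> cA; rewrite -[A]setCK; apply: measurableC; apply: open_measurable_rV.
exact: closed_openC.
Qed.

Lemma continuous_measurable_rV (f : 'rV[R]_n -> R) :
  continuous f -> measurable_fun setT f.
Proof.
move=> /continuousP cf; apply: (measurability _ (RGenOpens.measurableE R)).
move=> _ [_ [a [b ->] <-]]; rewrite setTI; apply: open_measurable_rV; apply: cf.
exact: (@interval_open _ (BRight a) (BLeft b)).
Qed.

Lemma coord_le_norm (x : 'rV[R]_n) i : `|x ord0 i| <= `|x|.
Proof.
rewrite [leRHS]/Num.norm/= mx_normrE.
exact: (le_bigmax 0 (fun ij : 'I_1 * 'I_n => `|x ij.1 ij.2|) (ord0, i)).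
Qed.

Definition cube (M : R) : set 'rV[R]_n := [set x | forall i, `|x ord0 i| <= M].

Lemma cubeE M : cube M = [set x | forall i, `[- M, M]%classic (x ord0 i)].
Proof.
by apply/seteqP; split=> x xM i; have := xM i; rewrite /= in_itv/= ler_norml.
Qed.

Lemma compact_cube M : compact (cube M).
Proof.
rewrite cubeE; apply: (@rV_compact R n (fun=> `[- M, M]%classic)) => i.
exact: segment_compact.
Qed.

Lemma closed_cube M : closed (cube M).
Proof.
by apply: compact_closed; [exact: norm_hausdorff|exact: compact_cube].
Qed.

Lemma measurable_cube M : measurable (cube M).
Proof. by apply: closed_measurable_rV; exact: closed_cube. Qed.

Lemma lebesgue_cube_lty M : (lebesgue_rV n (cube M) < +oo)%E.
Proof.
rewrite cubeE (@lebesgue_rV_box R n (fun=> `[- M, M]%classic)); last first.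
  by move=> i; exact: measurable_itv.
rewrite big_const; elim: #|_| => [|k IHk] /=; first exact: ltry.
apply: lte_mul_pinfty => //; rewrite lebesgue_measure_itv/= -?EFinB.
by case: ifP => _; rewrite ?ltry.
Qed.

Lemma integrable_on_cube (D : 'rV[R]_n -> R) (B M : R) :
    measurable_fun setT D -> (forall x, `|D x| <= B) ->
    (forall x, ~ cube M x -> D x = 0) ->
  (lebesgue_rV n).-integrable setT (EFin \o D).
Proof.
move=> mD DB D0.
have mC : measurable (cube M) by exact: measurable_cube.
have i1 : (lebesgue_rV n).-integrable setT (EFin \o \1_(cube M)).
  apply/integrableP; split; first exact/measurable_EFinP/measurable_indic.
  under eq_integral do rewrite /= ger0_norm ?indicE ?ler0n// -indicE.
  by rewrite integral_indic// setIT lebesgue_cube_lty.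
apply: (@le_integrable _ _ _ _ _ measurableT _
  (EFin \o (fun x => B * \1_(cube M) x))).
- exact/measurable_EFinP.
- move=> x _ /=; rewrite lee_fin indicE; case: (asboolP (cube M x)) => xM.
    by rewrite mem_set// mulr1 (le_trans (DB x))// ler_norm.
  by rewrite D0// normr0.
- exact: (integrableZl measurableT B i1).
Qed.

End borel_rV.

(** * Integration by parts for functions of class C^1 *)

(** A directional derivative depends only on the restriction of the function to
    the line; hence slices of a function inherit its partial derivatives, and a
    function of one coordinate has the derivatives known in dimension 1. *)
Lemma is_derive_along (R : realType) (V V' : normedModType R) (f : V -> R)
    (g : V' -> R) x v x' v' (d : R) :
    (forall h : R, f (h *: v + x) = g (h *: v' + x')) ->
  is_derive x v f d -> is_derive x' v' g d.
Proof.
move=> fg [df fd].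
have E : (fun h : R => h^-1 *: ((f \o shift x) (h *: v) - f x)) =
         (fun h : R => h^-1 *: ((g \o shift x') (h *: v') - g x')).
  apply/funext => h /=; rewrite fg.
  by have := fg 0; rewrite !scale0r !add0r => ->.
by split; [rewrite /derivable -E|rewrite /derive -E].
Qed.

Section cons_rV_calculus.
Context (R : realType) (n : nat).

Lemma cons_rV_lift_line (a h : R) (y : 'rV[R]_n) (j : 'I_n) :
  cons_rV (a, h *: basis_vec j + y) =
  h *: basis_vec (lift ord0 j) + cons_rV (a, y).
Proof.
apply/rowP => k; rewrite [RHS]mxE; case: (unliftP ord0 k) => [l|] ->.
  by rewrite !cons_rVS/= !mxE (inj_eq lift_inj).
by rewrite !cons_rV0/= !mxE/= mulr0 add0r.
Qed.

Lemma cons_rV0_line (a h : R) (y : 'rV[R]_n) :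
  cons_rV (h *: (1 : R) + a, y) = h *: basis_vec ord0 + cons_rV (a, y).
Proof.
apply/rowP => k; rewrite [RHS]mxE; case: (unliftP ord0 k) => [l|] ->.
  by rewrite !cons_rVS/= !mxE/= mulr0 add0r.
by rewrite !cons_rV0/= !mxE.
Qed.

Lemma ball_cons_rV (a a' e : R) (y y' : 'rV[R]_n) :
  ball a e a' -> ball y e y' -> ball (cons_rV (a, y)) e (cons_rV (a', y')).
Proof.
move=> aa' [e0 yy']; split=> // i k.
have -> : i = ord0 by exact: ord1.
case: (unliftP ord0 k) => [l|] ->; first by rewrite !cons_rVS; exact: yy'.
by rewrite !cons_rV0.
Qed.

Lemma continuous_cons_rVr (a : R) :
  continuous (fun y : 'rV[R]_n => cons_rV (a, y)).
Proof.
move=> y; apply/(@cvg_ballP _ _ _ _ (nbhs_filter y)) => e e0.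
apply: (@filterS _ _ (nbhs_filter y) _ _ _ (nbhsx_ballx y e e0)) => z yz.
by apply: ball_cons_rV => //; exact: ballxx.
Qed.

Lemma continuous_cons_rVl (y : 'rV[R]_n) :
  continuous (fun a : R => cons_rV (a, y)).
Proof.
move=> a; apply/(@cvg_ballP _ _ _ _ (nbhs_filter a)) => e e0.
apply: (@filterS _ _ (nbhs_filter a) _ _ _ (nbhsx_ballx a e e0)) => b ab.
by apply: ball_cons_rV => //; exact: ballxx.
Qed.

End cons_rV_calculus.

Lemma bounded_on_cube (R : realType) n (D : 'rV[R]_n -> R) (M : R) :
    continuous D -> (forall x, ~ cube M x -> D x = 0) ->
  exists B : R, forall x, `|D x| <= B.
Proof.
move=> cD D0.
have /compact_bounded[B [_ hB]] : compact (D @` cube M).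
  apply: continuous_compact; last exact: compact_cube.
  exact: continuous_subspaceT.
exists (Num.max 0 B + 1) => x.
have [xM|/D0->] := pselect (cube M x); last first.
  by rewrite normr0 addr_ge0// le_max lexx.
by apply: hB; [rewrite ltr_pwDr// le_max lexx orbT|exists x].
Qed.

(** By induction on the dimension: R^(n+1) carries the product of the measures
    on R and on R^n. For the first coordinate, Fubini integrates first along
    the lines parallel to it, where the fundamental theorem of calculus gives
    the difference of two values of psi outside its support. For any other
    coordinate, it integrates first over R^n, where the induction hypothesis
    applies to the slices. *)
Lemma integral_partial_eq0 (R : realType) n (i : 'I_n) (psi D : 'rV[R]_n -> R)
    (M : R) :
    continuous D -> (forall x, is_derive x (basis_vec i) psi (D x)) ->
    (forall x, ~ cube M x -> psi x = 0) ->
    (forall x, ~ cube M x -> D x = 0) ->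
  (\int[lebesgue_rV n]_x (D x)%:E = 0)%E.
Proof.
elim: n i psi D => [[]//|n IHn] i psi D cD dpsi psi0 D0.
have [B hB] := bounded_on_cube cD D0.
have mD := continuous_measurable_rV cD.
have iD := integrable_on_cube mD hB D0.
have mDc : measurable_fun setT (EFin \o D \o @cons_rV R n).
  by apply: measurableT_comp (@measurable_cons_rV R n); exact/measurable_EFinP.
have iDc : (lebesgue_measure \x lebesgue_rV n)%E.-integrable setT
    (EFin \o D \o @cons_rV R n).
  apply/integrableP; split=> //.
  move/integrableP : iD => [_]; apply: le_lt_trans.
  rewrite -[leRHS]/(\int[pushforward (lebesgue_measure \x lebesgue_rV n)
                       (@cons_rV R n)]_x (abse \o (EFin \o D)) x)%E.
  rewrite ge0_integral_pushforward//=.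
    exact: measurable_cons_rV.
  by apply: measurableT_comp => //; exact/measurable_EFinP.
transitivity (\int[lebesgue_measure \x lebesgue_rV n]_p (D (cons_rV p))%:E)%E.
  rewrite -[LHS]/(\int[pushforward (lebesgue_measure \x lebesgue_rV n)
                       (@cons_rV R n)]_x (EFin \o D) x)%E.
  rewrite integral_pushforward//; first exact: measurable_cons_rV.
  exact/measurable_EFinP.
have cubeS a y : ~ (`|(a : R)| <= M /\ cube M y) -> ~ cube M (cons_rV (a, y)).
  move=> + cM; apply; split=> [|l]; first by have := cM ord0; rewrite cons_rV0.
  by have := cM (lift ord0 l); rewrite cons_rVS.
case: (unliftP ord0 i) => [j|] iE; subst i.
  rewrite -(integral12_prod_meas1 iDc) integral0_eq// => a _.
  apply: (IHn j (fun y => psi (cons_rV (a, y)))).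
  - move=> y; apply: (continuous_comp (@continuous_cons_rVr _ _ a y)).
    exact: cD.
  - move=> y; apply: is_derive_along (dpsi (cons_rV (a, y))) => h.
    by rewrite cons_rV_lift_line.
  - by move=> y ny; apply: psi0; apply: cubeS => -[].
  - by move=> y ny; apply: D0; apply: cubeS => -[].
rewrite -(integral21_prod_meas1 iDc) integral0_eq// => y _.
rewrite /fubini_G /=.
pose F (a : R) : R := psi (cons_rV (a, y)).
pose f (a : R) : R := D (cons_rV (a, y)).
have dF a : is_derive (a : R) 1 F (f a).
  apply: is_derive_along (dpsi (cons_rV (a, y))) => h.
  by rewrite /F cons_rV0_line.
have cf : continuous f.
  move=> a; apply: (continuous_comp (@continuous_cons_rVl _ _ y a)).
  exact: cD.
have f0 a : M < `|a| -> f a = 0.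
  by move=> Ma; apply: D0; apply: cubeS => -[]; rewrite leNgt Ma.
have F0 a : M < `|a| -> F a = 0.
  by move=> Ma; apply: psi0; apply: cubeS => -[]; rewrite leNgt Ma.
(* L > M, so that F vanishes at both endpoints, and L > 0, so that the
   interval is nondegenerate. *)
pose L := Num.max M 0 + 1.
have L0 : 0 < L by rewrite ltr_pwDr// le_max lexx orbT.
have ML : M < L by rewrite ltr_pwDr// le_max lexx.
transitivity (\int[lebesgue_measure]_(a in `[(- L)%R, L]) (f a)%:E)%E.
  rewrite [RHS]integral_mkcond; apply: eq_integral => a _.
  rewrite patchE; case: ifPn => // /negP aL; rewrite -/(f a) f0//.
  rewrite ltNge; apply/negP => aM; apply: aL; rewrite inE/= in_itv/=.
  by rewrite -ler_norml (le_trans aM)// ltW.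
rewrite (@continuous_FTC2 _ f F).
- by rewrite !F0 ?normrN ?(gtr0_norm L0)// subee.
- by rewrite -subr_gt0 opprK addr_gt0.
- exact: continuous_subspaceT.
- have cF a : {for a, continuous F}.
    apply: differentiable_continuous; apply/derivable1_diffP.
    by apply: ex_derive.
  split; [by move=> a _; exact: ex_derive| |].
    exact: cvg_at_right_filter (cF _).
  exact: cvg_at_left_filter (cF _).
- by move=> a _; rewrite derive1E derive_val.
Qed.

(** The product g * phi is of class C^1 with compact support, so the integral
    of each of its partial derivatives vanishes. *)
Lemma is_weak_gradient_C1 (R : realType) n (g : 'rV[R]_n -> R)
    (G : 'rV[R]_n -> 'rV[R]_n) :
    continuous g -> (forall i, continuous (fun x => G x ord0 i)) ->
    (forall x i, is_derive x (basis_vec i) g (G x ord0 i)) ->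
  is_weak_gradient g G.
Proof.
move=> cg cG dg.
have loc (h : 'rV[R]_n -> R) : continuous h -> locally_integrable_rV h.
  move=> ch; have mh := continuous_measurable_rV ch; split=> // K cK.
  have mK : measurable K.
    apply: closed_measurable_rV; apply: compact_closed => //; exact: norm_hausdorff.
  have /compact_bounded[B [_ hB]] : compact (h @` K).
    by apply: continuous_compact => //; exact: continuous_subspaceT.
  have /compact_bounded[M [_ hM]] := cK.
  apply: (@le_lt_trans _ _
    (\int[lebesgue_rV n]_(x in K) (Num.max B 0 + 1)%:E)%E).
    apply: ge0_le_integral => //.
    - exact/measurable_EFinP/measurableT_comp/measurable_funTS.
    - move=> x Kx; rewrite lee_fin; apply: hB; last by exists x.
      by rewrite ltr_pwDr// le_max lexx.
  rewrite integral_cst// lte_mul_pinfty// ?lee_fin.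
    by rewrite addr_ge0// le_max lexx orbT.
  apply: le_lt_trans (lebesgue_cube_lty n (Num.max M 0 + 1)).
  apply: le_measure; rewrite ?inE//; first exact: measurable_cube.
  move=> x Kx i; apply: le_trans (coord_le_norm x i) _.
  by apply: hM => //; rewrite ltr_pwDr// le_max lexx.
split=> [|i|phi [dphi cphi Kphi] i]; [exact: loc|exact: loc|].
have /compact_bounded[M0 [_ hM]] := Kphi.
pose M := Num.max M0 0 + 1.
have phi0 x : ~ cube M x -> phi x = 0.
  apply: contra_notP => /eqP phix k; apply: le_trans (coord_le_norm x k) _.
  apply: (hM M); first by rewrite /M ltr_pwDr// le_max lexx.
  exact: subset_closure.
have Dphi0 x : ~ cube M x -> 'D_(basis_vec i) phi x = 0.
  move=> xM; rewrite (@near_eq_derive _ _ _ _ (cst 0)) ?derive_cst//.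
  have : open (~` @cube R n M) by apply: closed_openC; exact: closed_cube.
  rewrite openE => /(_ _ xM); apply: filterS => y; exact: phi0.
have cphi1 : continuous phi.
  by move=> x; exact/differentiable_continuous.
have cD1 : continuous (fun x => g x * 'D_(basis_vec i) phi x).
  by move=> x; exact: (cvgM (cg x) (cphi i x)).
have cD2 : continuous (fun x => G x ord0 i * phi x).
  by move=> x; exact: (cvgM (cG i x) (cphi1 x)).
have D10 x : ~ cube M x -> g x * 'D_(basis_vec i) phi x = 0.
  by move=> /Dphi0 ->; rewrite mulr0.
have D20 x : ~ cube M x -> G x ord0 i * phi x = 0.
  by move=> /phi0 ->; rewrite mulr0.
have int h : continuous h -> (forall x, ~ cube M x -> h x = 0) ->
    (lebesgue_rV n).-integrable setT (EFin \o h).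
  move=> ch h0; have [B hB] := bounded_on_cube ch h0.
  exact: integrable_on_cube (continuous_measurable_rV ch) hB h0.
apply/eqP; rewrite -addr_eq0 -RintegralD//; [|exact: int|exact: int].
rewrite /Rintegral.
pose D x := g x * 'D_(basis_vec i) phi x + G x ord0 i * phi x.
have -> // : (\int[lebesgue_rV n]_x (D x)%:E = 0)%E.
apply: (@integral_partial_eq0 _ _ i (g \* phi) D M).
- by move=> x; exact: (cvgD (cD1 x) (cD2 x)).
- move=> x; have dphix : is_derive x (basis_vec i) phi ('D_(basis_vec i) phi x).
    by apply: DeriveDef => //; exact: diff_derivable.
  by apply: is_derive_eq; rewrite /GRing.scale/= [phi x * _]mulrC.
- by move=> x /phi0 /=; rewrite /= => ->; rewrite mulr0.
- by move=> x xM; rewrite /D D10// D20// addr0.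
Qed.

(** * Poincaré constants are positive *)

Lemma hyperplane_null (R : realType) n (k : 'I_n) (t : R) :
  (lebesgue_rV n [set x : 'rV[R]_n | x ord0 k = t] = 0)%E.
Proof.
pose A i : set R := if i == k then [set t] else setT.
have -> : [set x : 'rV[R]_n | x ord0 k = t] =
    [set x | forall i, A i (x ord0 i)].
  apply/seteqP; split=> [x xt i|x /(_ k)]; rewrite /A ?eqxx//.
  by case: eqP => // ->.
rewrite (@lebesgue_rV_box R n A); last first.
  by move=> i; rewrite /A; case: ifP.
by rewrite (bigD1 k)//= /A eqxx lebesgue_measure_set1 mul0e.
Qed.

(** Were CP nonpositive, all functions to which the inequality applies would
    have variance zero. The test function g is arctan of a coordinate: it is
    bounded and of class C^1, whatever the decay of m, and it is injective in
    that coordinate, so its level sets are hyperplanes, which are null. *)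
Lemma poincare_constant_gt0 (R : realType) n (m : 'rV[R]_n -> R) (CP : R) :
    (1 <= n)%N -> measurable_fun setT m -> (forall x, 0 <= m x) ->
    {ae lebesgue_rV n, forall x, 0 < m x} ->
    (\int[lebesgue_rV n]_x (m x)%:E = 1)%E ->
  poincare m CP -> 0 < CP.
Proof.
move=> n1 mm m0 m_gt0 m1 P; rewrite ltNge; apply/negP => CP0.
pose k : 'I_n := Ordinal n1.
pose g (x : 'rV[R]_n) : R := atan (x ord0 k).
pose G (x : 'rV[R]_n) : 'rV[R]_n := (1 + x ord0 k ^+ 2)^-1 *: basis_vec k.
have ck : continuous (fun x : 'rV[R]_n => x ord0 k) by exact: coord_continuous.
have cg : continuous g.
  move=> x; rewrite /g; apply: continuous_comp; first exact: ck.
  exact: continuous_atan.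
have wg : weakly_differentiable g.
  exists G; apply: is_weak_gradient_C1 => //.
  - move=> i x; rewrite /G.
    have -> : (fun x : 'rV[R]_n => G x ord0 i) =
              (fun x => (1 + x ord0 k ^+ 2)^-1 * basis_vec k ord0 i).
      by apply/funext => y; rewrite /G mxE.
    have nz : 1 + x ord0 k ^+ 2 != 0 by rewrite gt_eqF// ltr_pwDl// sqr_ge0.
    exact: (cvgM (cvgV nz (cvgD (cvg_cst (1 : R)) (cvgM (ck x) (ck x))))
      (cvg_cst (basis_vec k ord0 i : R))).
  - move=> x i; rewrite !mxE/=; have [->|ik] := eqVneq i k.
      rewrite mulr1; apply: (@is_derive_along R R _ (@atan R) g (x ord0 k) 1).
      by move=> h; rewrite /g !mxE !eqxx.
    rewrite mulr0.
    apply: (@is_derive_along R R _ (cst (g x)) g 0 1).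
    by move=> h; rewrite /g !mxE/= eq_sym (negbTE ik) mulr0 add0r.
have gM x : `|g x| <= pi / 2 :> R.
  by rewrite ler_norml ltW ?atan_gtNpi2// ltW// atan_ltpi2.
have mg := continuous_measurable_rV cg.
have ig := integrable_bounded_density mm m0 m1 mg gM.
have ig2 := integrable_sqr_bounded_density mm m0 m1 mg gM.
have := P g wg; rewrite (EFin_Rintegral ig2) ltry => /(_ isT).
rewrite (EFin_Rintegral ig) -EFin_expe -EFinB.
rewrite -(variance_centered mm m0 m1 mg gM).
set a := \int[_]_x (g x * m x) => V.
have {}V : (\int[lebesgue_rV n]_x ((g x - a) ^+ 2 * m x) <= 0)%R.
  rewrite -lee_fin (le_trans V)// mule_le0_ge0 ?lee_fin//.
  apply: integral_ge0 => x _; rewrite lee_fin mulr_ge0// sumr_ge0// => i _.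
  exact: sqr_ge0.
have mga : measurable_fun setT (fun x => g x - a) by exact: measurable_funB.
pose h x := (g x - a) ^+ 2 * m x.
have mh : measurable_fun setT h.
  by apply: measurable_funM => //; exact: measurable_funX.
have h0 x : 0 <= h x by rewrite mulr_ge0// sqr_ge0.
have ih : (lebesgue_rV n).-integrable setT (EFin \o h).
  apply: (@integrable_sqr_bounded_density _ _ _ _ _ mm m0 m1 _ (pi / 2 + `|a|)).
    exact: mga.
  by move=> x; rewrite (le_trans (ler_normB _ _))// lerD2r.
have hae : {ae lebesgue_rV n, forall x, h x = 0}.
  apply: ge0_integral_eq0_ae => //; rewrite (EFin_Rintegral ih); congr EFin.
  by apply: le_anti; rewrite V Rintegral_ge0.
have nae : {ae lebesgue_rV n, forall x : 'rV[R]_n, x ord0 k <> tan a}.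
  exists [set x : 'rV[R]_n | x ord0 k = tan a]; split.
  - rewrite -[X in measurable X]setTI.
    by apply: (@measurable_rV_coord R n k measurableT [set tan a]).
  - exact: hyperplane_null.
  - by move=> x /= /contrapT.
(* The two facts exclude each other, so almost every point satisfies anything,
   in particular m = 0: this contradicts the mass 1 of m. *)
have m_eq0 : {ae lebesgue_rV n, forall x, m x = cst 0 x}.
  apply: filterS3 hae m_gt0 nae => x hx mx nx; exfalso; apply: nx.
  move/eqP: hx; rewrite mulf_eq0 (gt_eqF mx) orbF sqrf_eq0 subr_eq0.
  by move/eqP => <-; rewrite atanK.
have := ae_eq_integral_EFin mm (measurable_cst _) m_eq0.
by rewrite m1 integral0 => /eqP; rewrite eqe oner_eq0.
Qed.

(** * The minimizer and the energy in terms of u = f / m *)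

Section steady_state.
Context (R : realType) (n : nat) (r : R) (rho : 'rV[R]_n -> R).
Hypotheses (r0 : 0 < r) (rhoP : prob_density rho)
  (rho_gt0 : {ae lebesgue_rV n, forall x, 0 < rho x})
  (rho_fin : (\int[lebesgue_rV n]_x (rho x `^ (r + 1)^-1)%:E < +oo)%E).
Local Notation leb := (lebesgue_rV n).
Local Notation m := (minimizer r rho).
Local Notation gam := (gamma r rho).

Let r1 : 0 < r + 1. Proof. by rewrite addr_gt0. Qed.

Lemma measurable_rho_pow : measurable_fun setT (fun x => rho x `^ (r + 1)^-1).
Proof.
have [mrho _ _] := rhoP.
exact: (measurableT_comp (measurable_powR (r + 1)^-1) mrho).
Qed.

(** gamma is defined from a real-valued integral, which would be 0 if the
    integral were infinite; finiteness makes it the true integral. *)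
Lemma integral_rho_pow :
  (\int[leb]_x (rho x `^ (r + 1)^-1)%:E)%E = (gam^-1)%:E.
Proof.
rewrite /gamma invrK /Rintegral fineK// ge0_fin_numE//.
by apply: integral_ge0 => x _; rewrite lee_fin powR_ge0.
Qed.

Lemma gamma_gt0 : 0 < gam.
Proof.
have [mrho rho0 rho1] := rhoP.
rewrite -invr_gt0 lt0r; apply/andP; split; last first.
  rewrite -lee_fin -integral_rho_pow; apply: integral_ge0 => x _.
  by rewrite lee_fin powR_ge0.
apply/negP => /eqP g0; have := integral_rho_pow; rewrite g0.
move=> /(ge0_integral_eq0_ae measurable_rho_pow (fun=> powR_ge0 _ _)) E.
have : (\int[leb]_x (rho x)%:E = \int[leb]_x (cst 0 x)%:E)%E.
  apply: ae_eq_integral_EFin => //.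
  by apply: filterS E => x /powR_eq0_eq0.
by rewrite rho1 integral0 => /eqP; rewrite eqe oner_eq0.
Qed.

Lemma measurable_minimizer : measurable_fun setT m.
Proof. by apply: measurable_funM => //; exact: measurable_rho_pow. Qed.

Lemma minimizer_ge0 x : 0 <= m x.
Proof. by rewrite mulr_ge0 ?powR_ge0// ltW// gamma_gt0. Qed.

Lemma minimizer_gt0 : {ae leb, forall x, 0 < m x}.
Proof.
by apply: filterS rho_gt0 => x rx; rewrite mulr_gt0 ?powR_gt0// gamma_gt0.
Qed.

Lemma integral_minimizer : (\int[leb]_x (m x)%:E = 1)%E.
Proof.
under eq_integral do rewrite /minimizer EFinM.
rewrite ge0_integralZl_EFin//.
- by rewrite integral_rho_pow -EFinM mulfV// gt_eqF// gamma_gt0.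
- by move=> x _; rewrite lee_fin powR_ge0.
- by apply/measurable_EFinP; exact: measurable_rho_pow.
- by rewrite ltW// gamma_gt0.
Qed.

Lemma minimizer_powE x : m x `^ (r + 1) = gam `^ (r + 1) * rho x.
Proof.
have [_ rho0 _] := rhoP.
rewrite /minimizer powRM ?powR_ge0 ?(ltW gamma_gt0)//.
by rewrite -powRrM mulVf ?gt_eqF// powRr1.
Qed.

(** Pointwise, rho = m^(r+1) / gamma^(r+1), so rho / f^r is m (m / f)^r up to
    the constant. The ratio u is a parameter known only up to a null set, so
    that it may be chosen with bounds holding everywhere. *)
Lemma energyE (f u : 'rV[R]_n -> R) :
    measurable_fun setT f -> measurable_fun setT u -> (forall x, 0 < u x) ->
    {ae leb, forall x, f x = u x * m x} ->
    leb.-integrable setT (EFin \o (fun x => u x `^ (- r) * m x)) ->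
  energy r rho f =
  ((gam `^ (r + 1))^-1 * \int[leb]_x (u x `^ (- r) * m x))%:E.
Proof.
move=> mf mu u0 fE iu; have [mrho rho0 _] := rhoP.
have G0 : 0 < gam `^ (r + 1) by rewrite powR_gt0// gamma_gt0.
rewrite -RintegralZl// -EFin_Rintegral; last first.
  exact: (integrableZl measurableT _ iu).
apply: ae_eq_integral_EFin.
- apply: measurable_funM => //.
  under eq_fun do rewrite -powRN.
  exact: (measurableT_comp (measurable_powR (- r)) mf).
- apply: measurable_funM => //; apply: measurable_funM => //.
    exact: (measurableT_comp (measurable_powR (- r)) mu).
  exact: measurable_minimizer.
- apply: filterS2 minimizer_gt0 fE => x mx ->.
  have rhoE : rho x = (gam `^ (r + 1))^-1 * m x `^ (r + 1).
    by rewrite minimizer_powE mulKf// gt_eqF.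
  rewrite rhoE powRM ?ltW// powRN [m x `^ (r + 1)]powRD; last first.
    by rewrite (gt_eqF mx) implybT.
  rewrite powRr1 ?ltW//.
  by field; rewrite !gt_eqF// powR_gt0.
Qed.

End steady_state.

(** * The energy gap and the dissipation *)

Lemma deficit_constant_le (R : realType) (r c C : R) :
    0 < r -> 0 < c -> c <= 1 -> 1 <= C ->
  r / (2 * (r + 1)) * C `^ (r + 2) / c <=
  r / (2 * (r + 1)) * C `^ (2 * r + 3) / c `^ (r + 2).
Proof.
move=> r0 c0 c1 C1.
have C0 : 0 < C by rewrite (lt_le_trans ltr01).
have r1 : 0 <= r / (2 * (r + 1)).
  by rewrite divr_ge0 ?mulr_ge0// ?addr_ge0// ltW.
have CC : C `^ (r + 2) <= C `^ (2 * r + 3) by apply: ler_powR => //; lra.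
have cc : c `^ (r + 2) <= c by apply: ge1r_powR; [rewrite c0|lra].
apply: ler_pM => //.
- by rewrite mulr_ge0// powR_ge0.
- by rewrite invr_ge0 ltW.
- exact: ler_wpM2l.
- by rewrite lef_pV2// posrE powR_gt0.
Qed.

Lemma measurable_sqnorm_weak_gradient (R : realType) n (g : 'rV[R]_n -> R) :
    weakly_differentiable g ->
  measurable_fun setT (fun x => sqnorm (weak_gradient g x)).
Proof.
move=> wg; have [_ lG _] : is_weak_gradient g (weak_gradient g).
  exact: xgetPex.
by apply: measurable_sum => i; apply: measurable_funX; have [] := lG i.
Qed.

Lemma sqnorm_ge0 (R : realType) n (v : 'rV[R]_n) : 0 <= sqnorm v.
Proof. by apply: sumr_ge0 => i _; exact: sqr_ge0. Qed.

Theorem theorem5 (R : realType) (n : nat) (r : R) (rho : 'rV[R]_n -> R)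
    (c C CP : R) :
  (1 <= n)%N ->
  1 < r ->
  prob_density rho ->
  {ae lebesgue_rV n, forall x, 0 < rho x} ->
  (\int[lebesgue_rV n]_x (rho x `^ (r + 1)^-1)%:E < +oo)%E ->
  0 < c -> c <= 1 -> 1 <= C ->
  poincare (minimizer r rho) CP ->
  forall f : 'rV[R]_n -> R, pinched_density (minimizer r rho) c C f ->
    (energy r rho f - energy r rho (minimizer r rho)
     <= (CP * C `^ (2 * r + 3)
         / (2 * r * (r + 1) * gamma r rho `^ (r + 1) * c `^ (r + 2)))%:E
        * dissipation r rho f)%E.
Proof.
move=> n1 r_gt1 rhoP rho_gt0 rho_fin c0 c1 C1 P f [[mf f0 f1] fcC].
have r0 : 0 < r by rewrite (lt_trans ltr01).
have r10 : 0 < r + 1 by rewrite addr_gt0.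
set leb := @lebesgue_rV R n; set m := minimizer r rho.
have mm : measurable_fun setT m by exact: measurable_minimizer.
have m0 : forall x, 0 <= m x by exact: minimizer_ge0.
have m_gt0 : {ae leb, forall x, 0 < m x} by exact: minimizer_gt0.
have m1 : (\int[leb]_x (m x)%:E = 1)%E by exact: integral_minimizer.
have CP0 : 0 < CP by exact: poincare_constant_gt0 mm m0 m_gt0 m1 P.
have gam0 : 0 < gamma r rho by exact: gamma_gt0.
set Gam := gamma r rho `^ (r + 1).
have Gam0 : 0 < Gam by exact: powR_gt0.
have C0 : 0 < C by rewrite (lt_le_trans ltr01).
set K : R := (X in X%:E).
have K0 : 0 < K.
  by rewrite divr_gt0 ?mulr_gt0 ?powR_gt0.
(* u is the ratio v = f / m truncated to [c, C]: it agrees with v almost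
   everywhere and satisfies the bounds everywhere. *)
pose v x := f x / m x.
pose u x := Num.max c (Num.min C (v x)).
have mv : measurable_fun setT v.
  rewrite (_ : v = fun x => f x * m x `^ (-1)); last first.
    by apply/funext => x; rewrite powR_inv1.
  apply: measurable_funM => //.
  exact: (measurableT_comp (measurable_powR (-1)) mm).
have mu_ : measurable_fun setT u.
  by apply: measurable_maxr => //; exact: measurable_minr.
have cuC x : c <= u x <= C.
  by rewrite le_max lexx/= ge_max ge_min lexx/= (le_trans c1 C1).
have u0 x : 0 < u x by case/andP: (cuC x) => /(lt_le_trans c0).
have uv : {ae leb, forall x, u x = v x}.
  apply: filterS2 m_gt0 fcC => x mx /andP[cf fC].
  rewrite /u /v (min_idPr _) ?ler_pdivrMr// (max_idPr _)// ler_pdivlMr//.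
have fu : {ae leb, forall x, f x = u x * m x}.
  by apply: filterS2 m_gt0 uv => x mx ->; rewrite /v divfK// gt_eqF.
have mpow p : measurable_fun setT (fun x => u x `^ p).
  exact: (measurableT_comp (measurable_powR p) mu_).
have powN_bd p x : 0 <= p -> `|u x `^ (- p)| <= c `^ (- p).
  move=> p0; rewrite ger0_norm ?powR_ge0//; apply: ler_powRN => //.
  by case/andP: (cuC x).
have iur := integrable_bounded_density mm m0 m1 (mpow _)
  (fun x => powN_bd _ x (ltW r0)).
have Ef : energy r rho f = (Gam^-1 * \int[leb]_x (u x `^ (- r) * m x))%:E.
  exact: energyE.
have Em : energy r rho m = Gam^-1%:E.
  rewrite (@energyE _ _ r rho r0 rhoP rho_gt0 rho_fin _ (cst 1))//.
  - under eq_Rintegral do rewrite powR1 mul1r.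
    by rewrite (Rintegral_density m1) mulr1.
  - by apply: nearW => x; rewrite mul1r.
  - under eq_fun do rewrite powR1 mul1r.
    exact: (integrable_density mm m0 m1).
have u1 : \int[leb]_x (u x * m x) = 1.
  rewrite /Rintegral -(@ae_eq_integral_EFin _ _ _ _ f) ?f1//.
  exact: measurable_funM.
have D := powR_deficit_le_variance mm m0 m1 r0 c0 mu_ cuC u1.
rewrite Ef Em -EFinB /dissipation.
set w := fun x => _ `^ (- (r + 1)).
(* Without a weak gradient the right side is K * +oo, with K > 0. *)
case: asboolP => [wd|_]; last by rewrite gt0_muley ?lte_fin// leey.
pose wu x := u x `^ (- (r + 1)).
have wuw : {ae leb, forall x, wu x = w x}.
  by apply: filterS uv => x E; rewrite /wu E.
have mw : measurable_fun setT w.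
  exact: (measurableT_comp (measurable_powR _) mv).
have wu_bd x : `|wu x| <= c `^ (- (r + 1)) := powN_bd _ x (ltW r10).
have iwu := integrable_bounded_density mm m0 m1 (mpow _) wu_bd.
have iwu2 := integrable_sqr_bounded_density mm m0 m1 (mpow _) wu_bd.
have Ew : (\int[leb]_x (w x * m x)%:E = (\int[leb]_x (wu x * m x))%:E)%E.
  rewrite -(EFin_Rintegral iwu); apply: ae_eq_integral_EFin.
  - exact: measurable_funM.
  - by apply: measurable_funM => //; exact: mpow.
  - by apply: filterS wuw => x <-.
have Ew2 : (\int[leb]_x (w x ^+ 2 * m x)%:E =
    (\int[leb]_x (wu x ^+ 2 * m x))%:E)%E.
  rewrite -(EFin_Rintegral iwu2); apply: ae_eq_integral_EFin.
  - by apply: measurable_funM => //; exact: measurable_funX.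
  - by apply: measurable_funM => //; apply: measurable_funX; exact: mpow.
  - by apply: filterS wuw => x <-.
have := P w wd; rewrite Ew2 ltry Ew => /(_ isT).
rewrite -EFin_expe -EFinB; set V := _ - _ => VX.
have msq := measurable_sqnorm_weak_gradient wd.
set X := (\int[leb]_x (sqnorm (weak_gradient w x) * m x)%:E)%E in VX.
set Y := (\int[leb]_x (v x * sqnorm (weak_gradient w x) * m x)%:E)%E.
have y0 x : 0 <= v x * sqnorm (weak_gradient w x) * m x.
  apply: mulr_ge0 => //; apply: mulr_ge0; first exact: divr_ge0.
  exact: sqnorm_ge0.
have Y0 : (0 <= Y)%E by apply: integral_ge0 => x _; rewrite lee_fin.
have my : measurable_fun setT
    (fun x => (v x * sqnorm (weak_gradient w x) * m x)%:E).
  apply/measurable_EFinP; apply: measurable_funM => //.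
  exact: measurable_funM.
have ci0 : 0 <= c^-1 by rewrite invr_ge0 ltW.
(* 1 <= u / c puts the weight u of the dissipation under the integral. *)
have XY : (X <= c^-1%:E * Y)%E.
  rewrite /Y -ge0_integralZl_EFin//; last by move=> x _; rewrite lee_fin.
  apply: ae_ge0_le_integral => //.
  - by move=> x _; rewrite lee_fin; apply: mulr_ge0 => //; exact: sqnorm_ge0.
  - by apply/measurable_EFinP; exact: measurable_funM.
  - by move=> x _; rewrite -EFinM lee_fin; exact: mulr_ge0.
  - exact: measurable_funeM.
  - apply: filterS uv => x uvx _; rewrite -EFinM lee_fin [leRHS]mulrA.
    apply: ler_wpM2r => //; rewrite mulrA.
    apply: ler_peMl; first exact: sqnorm_ge0.
    by rewrite mulrC ler_pdivlMr// mul1r -uvx; case/andP: (cuC x).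
set A := r / (2 * (r + 1)) * C `^ (r + 2) in D.
have A0 : 0 <= A by rewrite mulr_ge0 ?powR_ge0// divr_ge0 ?mulr_ge0// ltW.
have GA0 : (0 <= (Gam^-1 * A)%:E)%E.
  by rewrite lee_fin; apply: mulr_ge0 => //; rewrite invr_ge0 ltW.
apply: (@le_trans _ _ ((Gam^-1 * A)%:E * (CP%:E * (c^-1%:E * Y)))%E).
  apply: (@le_trans _ _ ((Gam^-1 * A)%:E * V%:E)%E).
    rewrite -EFinM lee_fin -mulrA -[X in _ - X]mulr1 -mulrBr.
    by apply: ler_wpM2l => //; rewrite invr_ge0 ltW.
  apply: lee_wpmul2l => //.
  by apply: (le_trans VX); apply: lee_wpmul2l => //; rewrite lee_fin ltW.
rewrite !muleA -!EFinM; apply: lee_wpmul2r => //; rewrite lee_fin.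
have -> : K * r ^+ 2 = Gam^-1 * CP *
    (r / (2 * (r + 1)) * C `^ (2 * r + 3) / c `^ (r + 2)).
  by rewrite /K; field; rewrite !gt_eqF// ?powR_gt0.
have -> : Gam^-1 * A * CP * c^-1 = Gam^-1 * CP * (A / c) by ring.
apply: ler_wpM2l; last exact: deficit_constant_le.
by rewrite mulr_ge0// ?invr_ge0 ltW.
Qed.
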